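(* For all $n\geq 2$, the number of desarrangements of length $n$ avoiding both $132$ and $231$ is $d_n(132,231)=2^{n-2}$.
   Context: Permutations are in one-line notation. An index $i\in[n-1]$ is a descent of $\pi\in\mathfrak{S}_n$ if $\pi_i>\pi_{i+1}$; $i\in[n]$ is an ascent if it is not a descent (so $n$ is always an ascent). A desarrangement is a permutation whose first ascent is even. $d_n(\Pi)$ is the number of desarrangements in $\mathfrak{S}_n$ avoiding every pattern in $\Pi$ ($\pi$ avoids $\sigma$ if no subsequence of $\pi$ has the same relative order as $\sigma$). *)

(* Defs.v *)
From mathcomp Require Import all_boot all_fingroup.

Set Implicit Arguments.
Unset Strict Implicit.
Unset Printing Implicit Defensive.

(* Descent and ascent indices are 1-based, whereas positions and values of
   p : 'S_n are 0-based: the entry of index i in one-line notation is the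
   value of p at the ordinal i - 1. *)

Definition is_descent (n : nat) (p : 'S_n) (i : nat) : bool :=
  [exists a : 'I_n, exists b : 'I_n,
     [&& a.+1 == i, b == i :> nat & p b < p a]].

Definition is_ascent (n : nat) (p : 'S_n) (i : nat) : bool :=
  (1 <= i <= n) && ~~ is_descent p i.

(* The default 0 is only reached for n = 0, since n is an ascent when n > 0;
   it makes the empty permutation a desarrangement, as is customary. *)
Definition first_ascent (n : nat) (p : 'S_n) : nat :=
  head 0 [seq i <- iota 1 n | is_ascent p i].

Definition desarrangement (n : nat) (p : 'S_n) : bool :=
  ~~ odd (first_ascent p).

(* A pattern is given by its one-line notation, e.g. 132 is [:: 1; 3; 2]. *)
Definition contains_pattern (n : nat) (p : 'S_n) (s : seq nat) : bool :=
  [exists f : {ffun 'I_(size s) -> 'I_n},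
     [forall a : 'I_(size s), forall b : 'I_(size s),
        ((a < b) ==> (f a < f b)) &&
        ((p (f a) < p (f b)) == (nth 0 s a < nth 0 s b))]].

Definition avoids (n : nat) (p : 'S_n) (s : seq nat) : bool :=
  ~~ contains_pattern p s.

Definition desarr_count (n : nat) (Pi : seq (seq nat)) : nat :=
  #|[set p : 'S_n | desarrangement p && all (avoids p) Pi]|.

(* Main.v *)
Require Import Defs.
From mathcomp Require Import all_boot all_fingroup.
From mathcomp Require Import zify.

(** A permutation avoids 132 and 231 exactly when no entry is larger than both
    an entry to its left and an entry to its right, i.e. when it decreases down
    to its minimum and increases afterwards.  Its first ascent is then the index
    of the minimum.  Such a permutation has its maximum at one of its two ends;
    prepending a new maximum shifts the minimum by one, appending it does not.
    Hence in each size at least 2 both parities of the index are equally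
    frequent, and each is as frequent as all such permutations of the previous
    size. *)

Definition peakless {n : nat} (p : 'S_n) : bool :=
  [forall i : 'I_n, forall j : 'I_n, forall k : 'I_n,
     ~~ [&& i < j, j < k, p i < p j & p k < p j]].

Lemma peaklessP (n : nat) (p : 'S_n) :
  reflect (forall i j k : 'I_n, i < j -> j < k -> p i < p j -> p k < p j -> False)
          (peakless p).
Proof.
apply: (iffP idP) => [/forallP pp i j k ij jk pij pkj|pp].
  by move: (pp i) => /forallP/(_ j)/forallP/(_ k); rewrite ij jk pij pkj.
apply/forallP => i; apply/forallP => j; apply/forallP => k.
by apply/negP => /and4P[]; apply: pp.
Qed.

Lemma contains_pattern3P (n : nat) (p : 'S_n) (x y z : nat) :
  reflect (exists i j k : 'I_n, [/\ i < j < k,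
             (p i < p j) = (x < y) /\ (p j < p i) = (y < x),
             (p i < p k) = (x < z) /\ (p k < p i) = (z < x) &
             (p j < p k) = (y < z) /\ (p k < p j) = (z < y)])
          (contains_pattern p [:: x; y; z]).
Proof.
apply: (iffP existsP) => [[f /forallP fP]|].
  have H (a b : 'I_3) : (a < b -> f a < f b) /\
      (p (f a) < p (f b)) = (nth 0 [:: x; y; z] a < nth 0 [:: x; y; z] b).
    by move: (fP a) => /forallP/(_ b)/andP[/implyP ? /eqP ?].
  pose a := @Ordinal 3 0 isT; pose b := @Ordinal 3 1 isT.
  pose c := @Ordinal 3 2 isT.
  exists (f a), (f b), (f c).
  by rewrite (H a b).1 // (H b c).1 // !(H _ _).2.
move=> [i [j [k [/andP[ij jk] [e1 e2] [e3 e4] [e5 e6]]]]].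
exists [ffun a : 'I_3 => nth i [:: i; j; k] a].
apply/forallP => -[[|[|[|//]]] ?]; apply/forallP => -[[|[|[|//]]] ?];
  rewrite !ffunE /= ?ltnn ?ij ?jk ?(ltn_trans ij jk) ?eqxx //=; exact/eqP.
Qed.

(** The two outer entries of a peak are distinct, and their order decides whether the peak is a 132
    or a 231. *)
Lemma avoids_132_231 (n : nat) (p : 'S_n) :
  all (avoids p) [:: [:: 1; 3; 2]; [:: 2; 3; 1]] = peakless p.
Proof.
rewrite /= andbT /avoids -negb_or; apply/idP/peaklessP.
  move=> /norP[n1 n2] i j k ij jk pij pkj.
  have ne : p i != p k :> nat by rewrite (inj_eq val_inj) (inj_eq perm_inj) -val_eqE /=; lia.
  have [lt|ge] := ltnP (p i) (p k).
    move/negP: n1; apply; apply/contains_pattern3P; exists i, j, k; split; lia.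
  move/negP: n2; apply; apply/contains_pattern3P; exists i, j, k; split; lia.
by move=> pp; apply/norP; split; apply/contains_pattern3P;
  move=> [i [j [k [/andP[ij jk] [e1 _] _ [_ e2]]]]];
  apply: (pp i j k); rewrite ?e1 ?e2.
Qed.

Lemma is_descentE (n : nat) (p : 'S_n) (a b : 'I_n) :
  b = a.+1 :> nat -> is_descent p b = (p b < p a).
Proof.
move=> ba; apply/existsP/idP => [[a' /existsP[b' /and3P[/eqP ea /eqP eb]]]|lt].
  have -> : a' = a by apply: val_inj => /=; lia.
  by have -> : b' = b by apply: val_inj.
by exists a; apply/existsP; exists b; rewrite lt ba !eqxx.
Qed.

Lemma first_ascent_eq (n : nat) (p : 'S_n) (m : nat) :
  is_ascent p m -> (forall i, 0 < i < m -> is_descent p i) ->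
  first_ascent p = m.
Proof.
move=> am dm; have /andP[/andP[m0 mn] _] := am.
rewrite /first_ascent; have -> : iota 1 n = iota 1 (m.-1 + (n - m).+1).
  by congr iota; lia.
rewrite iotaD filter_cat (eq_in_filter (a2 := pred0)) => [|i].
  by rewrite filter_pred0 /= add1n prednK // am.
by rewrite mem_iota /= => im; rewrite /is_ascent dm ?andbF //; lia.
Qed.

(** No descent starts at the minimum. An ascent before it would end in a larger entry that has the
    minimum further right, hence a peak. The successor turns a 0-based position into a 1-based
    index. *)
Lemma first_ascent_peakless (n : nat) (p : 'S_n.+1) :
  peakless p -> first_ascent p = ((p^-1)%g ord0).+1.
Proof.
move=> /peaklessP pp; set m := (p^-1)%g ord0.
have pm : p m = ord0 by rewrite permKV.
have p0 i : (0 < p i) = (i != m).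
  by rewrite lt0n -(inj_eq (@perm_inj _ p)) pm.
apply: first_ascent_eq => [|i /andP[i0 im]].
  rewrite /is_ascent /= ltn_ord /=.
  apply/existsP => -[a /existsP[b /and3P[/eqP[/val_inj->] _]]].
  by rewrite pm.
have i1n : i.-1 < n.+1 by have := ltn_ord m; lia.
have iN : i < n.+1 by have := ltn_ord m; lia.
(* The 0-based positions of the indices [i] and [i + 1]; unless [b] is [m], an ascent here makes
   [a], [b], [m] a peak. *)
pose a := Ordinal i1n; pose b := Ordinal iN.
rewrite (is_descentE _ p a b) /=; last by rewrite prednK.
rewrite ltnNge leq_eqVlt (inj_eq val_inj) (inj_eq perm_inj) -val_eqE /=.
apply/negP => /orP[/eqP|pab]; first lia.
have [bm|bm] := eqVneq b m; first by move: pab; rewrite bm pm.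
apply: (pp a b m) => //=; first lia.
  by move: bm im; rewrite -val_eqE /=; lia.
by rewrite pm p0.
Qed.

(** [lift_perm i j s] inserts the value [j] at position [i] of [s], raising the values from [j] on.
    Injectivity suffices, as both sides have [(n+1)!] elements. *)
Lemma lift_perm_bij (n : nat) (i : 'I_n.+1) :
  bijective (fun js : 'I_n.+1 * 'S_n => lift_perm i js.1 js.2).
Proof.
apply: inj_card_bij; last by rewrite card_prod card_ord !card_Sn factS.
move=> [j s] [j' s'] /= e.
have ej : j = j' by rewrite -(lift_perm_id i j s) e lift_perm_id.
congr (_, _) => //; apply/permP => k; apply: (@lift_inj _ j).
by rewrite -(lift_perm_lift i) e ej lift_perm_lift.
Qed.

Lemma lift_permP (n : nat) (i : 'I_n.+1) (p : 'S_n.+1) :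
  exists s : 'S_n, p = lift_perm i (p i) s.
Proof.
have [g _ gK] := lift_perm_bij n i.
by case: (g p) (gK p) => j s /= <-; exists s; rewrite lift_perm_id.
Qed.

Lemma ltn_lift (n : nat) (h : 'I_n.+1) (i j : 'I_n) :
  (lift h i < lift h j) = (i < j).
Proof. by rewrite !ltnNge leq_bump2. Qed.

(** A maximum at an end is never the middle of a peak, and being maximal it is never one of the
    lower sides. *)
Lemma peakless_lift_perm (n : nat) (i : 'I_n.+1) (s : 'S_n) :
  (i == ord0) || (i == ord_max) ->
  peakless (lift_perm i ord_max s) = peakless s.
Proof.
move=> iE; apply/peaklessP/peaklessP => pp a b c.
  move=> ab bc sab scb; apply: (pp (lift i a) (lift i b) (lift i c));
  by rewrite ?lift_perm_lift ltn_lift.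
have [b' -> | ->] := unliftP i b; last first.
  by case/orP: iE => /eqP-> //= _; have := ltn_ord c; lia.
have max_gt j : lift ord_max (s j) < n by rewrite lift_max.
have [a' -> | ->] := unliftP i a; last first.
  by move=> _ _; rewrite lift_perm_id lift_perm_lift ltnNge ltnW.
have [c' -> | ->] := unliftP i c; last first.
  by move=> _ _ _; rewrite lift_perm_id lift_perm_lift ltnNge ltnW.
by rewrite !lift_perm_lift !ltn_lift; apply: pp.
Qed.

(** An interior maximum would form a peak with the two end entries. *)
Lemma peakless_max (n : nat) (p : 'S_n.+1) :
  peakless p -> (p ord0 == ord_max) || (p ord_max == ord_max).
Proof.
move=> /peaklessP pp; pose m := (p^-1)%g ord_max.
have pm : p m = ord_max by rewrite permKV.
have pE i : (p i == ord_max) = (i == m).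
  by rewrite -{1}pm (inj_eq perm_inj).
rewrite !pE; apply/norP => -[m0 mM].
have lt_pm i : i != m -> p i < p m.
  rewrite -(inj_eq (@perm_inj _ p)) pm -val_eqE /=.
  by have := ltn_ord (p i); lia.
apply: (pp ord0 m ord_max); try exact: lt_pm.
  by move: m0; rewrite -val_eqE /=; lia.
by rewrite ltn_neqAle eq_sym (inj_eq val_inj) mM -ltnS ltn_ord.
Qed.

(** The position is 0-based, so [b = true] means an even first ascent. *)
Definition peakless_parity (n : nat) (b : bool) : {set 'S_n.+1} :=
  [set p | peakless p && (odd ((p^-1)%g ord0) == b)].

Lemma odd_min_lift_perm (n : nat) (i : 'I_n.+2) (s : 'S_n.+1) :
  odd (((lift_perm i ord_max s)^-1)%g ord0) = odd (lift i ((s^-1)%g ord0)).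
Proof.
by rewrite lift_permV -(lift_perm_lift ord_max); congr (odd (lift_perm _ _ _ _));
  apply: val_inj.
Qed.

(** The summands count insertions of the maximum in front, which flip the parity, and at the end,
    which keep it. *)
Lemma card_peakless_parityS (n : nat) (b : bool) :
  #|peakless_parity n.+1 b| =
    #|peakless_parity n (~~ b)| + #|peakless_parity n b|.
Proof.
have lp_inj i : injective (@lift_perm n.+1 i ord_max).
  by move=> s t e; have /bij_inj/(_ (_, s) (_, t) e)[] := lift_perm_bij n.+1 i.
rewrite -(card_imset _ (lp_inj ord0)) -(card_imset _ (lp_inj ord_max)).
(* The two images are disjoint: the entry at position 0 is the maximum in the first and not in the
   second. *)
rewrite -cardsUI [X in _ = _ + X](_ : _ = 0) ?addn0; last first.
  apply/eqP; rewrite cards_eq0 -subset0; apply/subsetP => p.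
  rewrite inE => /andP[/imsetP[s _ ->] /imsetP[t _ /permP/(_ ord0)]].
  have e0 : ord0 = lift ord_max ord0 :> 'I_n.+2 by apply: val_inj.
  by rewrite lift_perm_id {1}e0 lift_perm_lift => /eqP; rewrite eq_liftF.
apply: eq_card => p; rewrite !inE; apply/andP/orP => [[pp /eqP ob]|].
  case/orP: (peakless_max _ _ pp) => /eqP pM; [left|right].
    have [s ps] := lift_permP _ ord0 p; rewrite pM in ps.
    move: pp ob; rewrite {}ps odd_min_lift_perm peakless_lift_perm // => pp ob.
    by apply: imset_f; rewrite inE pp -ob /= negbK eqxx.
  have [s ps] := lift_permP _ ord_max p; rewrite pM in ps.
  move: pp ob; rewrite {}ps odd_min_lift_perm lift_max.
  rewrite peakless_lift_perm ?eqxx ?orbT // => pp ob.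
  by apply: imset_f; rewrite inE pp ob /= eqxx.
case=> /imsetP[s]; rewrite inE => /andP[sp /eqP ob] ->.
  by rewrite peakless_lift_perm // odd_min_lift_perm lift0 /= ob negbK eqxx.
by rewrite peakless_lift_perm ?eqxx ?orbT // odd_min_lift_perm lift_max ob eqxx.
Qed.

Lemma card_peakless_parity (n : nat) (b : bool) :
  #|peakless_parity n.+1 b| = 2 ^ n.
Proof.
elim: n b => [|n IHn] b; last by rewrite card_peakless_parityS !IHn expnS mul2n addnn.
rewrite card_peakless_parityS.
(* In size 1 the minimum is at position 0, so the parities are unbalanced; the closed form starts at
   size 2. *)
have base c : #|peakless_parity 0 c| = ~~ c.
  have e p : (p \in peakless_parity 0 c) = ~~ c.
    have -> : (p \in peakless_parity 0 c) = (false == c); last by case: c.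
    rewrite inE ord1 /=.
    by have -> : peakless p by apply/peaklessP => i j k; rewrite !ord1.
  case: c e => e; first by apply: eq_card0.
  by rewrite (eq_card (B := predT)) ?card_Sn // => p; rewrite e.
by rewrite !base; case: b.
Qed.

Theorem theorem3p14 (n : nat) (hn : 2 <= n) :
  desarr_count n [:: [:: 1; 3; 2]; [:: 2; 3; 1]] = 2 ^ (n - 2).
Proof.
case: n hn => [|[|n]] // _; rewrite !subSS subn0 -(card_peakless_parity n true).
apply: eq_card => p; rewrite !inE avoids_132_231 andbC.
case: (boolP (peakless p)) => //= pp.
by rewrite /desarrangement first_ascent_peakless //= negbK eqb_id.
Qed.
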